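(* Let $\alpha$ be a reward sharing scheme. Then $\alpha$ satisfies round based rewards, budget limit, fixed total reward, ordinality, absolute redistribution and relative redistribution if and only if it is $k$-pseudo proportional for some $k$, i.e. if and only if there exist a constant $R=B-f$ with $f\in[0,B]$, some $k\in\{2,3,4,\dots\}\cup\{\infty\}$ and some $\delta\in[0,R]$ such that for every history $H=(S,\mathcal{P}(S))$ and every share $s\in S$, $$\alpha(s,H)=\begin{cases}\frac{R}{|P(s)|}, & \text{if } |P(s)|<k,\\[2pt] \frac{R-\delta}{k-1}, & \text{if } |P(s)|\ge k\text{ and }\rho(s)<k,\\[2pt] \delta, & \text{if }|P(s)|\ge k\text{ and }\rho(s)=k,\\[2pt] 0, & \text{if }|P(s)|\ge k\text{ and }\rho(s)>k.\end{cases}$$ (For $k=\infty$ only the first case occurs.)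
   Context: $B>0$ is a fixed constant (the block reward). Shares and histories. Let $\mathcal{S}$ be a nonempty set (of admissible hashes) and $T=\mathbb{R}$ the set of time signatures. A share is a pair $s=(h,t)\in\mathcal{S}\times T$; its time signature is $\tau(s)=t$. A history is a pair $H=(S,\mathcal{P}(S))$ where $S=\{s_1,\dots,s_m\}$ is a nonempty finite set of shares with pairwise distinct time signatures, listed in increasing order of time signature, and $\mathcal{P}(S)=\{P_1,\dots,P_l\}$ is a partition of $S$ into nonempty sets of consecutive shares, called rounds, numbered in chronological order (the last share of each round is the ''full solution'' ending that round; this information is carried only by the partition). For $s\in S$, $P(s)$ is the round containing $s$, and $\rho(s)=|\{s'\in P(s):\tau(s')<\tau(s)\}|+1$ is the rank of $s$ in its round. A reward sharing scheme $\alpha$ assigns to every history $H=(S,\mathcal{P}(S))$ and every $s\in S$ an award $\alpha(s,H)\in\mathbb{R}_+=[0,\infty)$. Restriction: for a history $H$ and a round $P_r$ of it, $H|_r=(P_r,\{P_r\})$. Extension: $H'=(S',\mathcal{P}'(S'))$ is an extension of $H$ at the $r$-th round if $S'=S\cup\{s^*\}$ for a share $s^*\notin S$ with $\tau(\underline{s})<\tau(s^* )<\tau(\overline{s})$ for all $\underline{s}\in P_r$ and all $\overline{s}\in P_{r+1}$ (the latter inequality only if round $r+1$ exists), $P'_k=P_k$ for all $k\ne r$, and $P'_r=P_r\cup\{s^*\}$. Time-shift: for $s_i\in P_r$, $H'=(S',\mathcal{P}'(S'))$ is a time-shift of $H$ at $s_i$ if $S'=(S\setminus\{s_i\})\cup\{s_i'\}$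 for some share $s_i'\in(\mathcal{S}\times T)\setminus S$ with $\tau(s_{i-1})<\tau(s_i')<\tau(s_{i+1})$ (an inequality being dropped if the corresponding neighbouring share does not exist), $P'_j=P_j$ for all $j\neq r$, and hence $P'_r=(P_r\setminus\{s_i\})\cup\{s_i'\}$. Axioms for a scheme $\alpha$: - Fixed total reward: for every history $H=(S,\mathcal{P}(S))$ and all rounds $P,P'\in\mathcal{P}(S)$, $\sum_{s\in P}\alpha(s,H)=\sum_{s\in P'}\alpha(s,H)$. - Ordinality: for every $H=(S,\mathcal{P}(S))$ and every time-shift $H'$ of $H$ at any $s_i\in S$, $\alpha(s,H)=\alpha(s,H')$ for all $s\in S\setminus\{s_i\}$. - Budget limit: for every history $H$ and every round $P$ of $H$, $\sum_{s\in P}\alpha(s,H)\le B$. - Round based rewards: for every history $H$, every round $P_r$ of $H$ and every $s\in P_r$, $\alpha(s,H)=\alpha(s,H|_r)$. - Absolute redistribution: for every history $H$, every round $P_r$ with $|P_r|>1$, every extension $H'$ of $H$ at the $r$-th round, and all $s_i,s_j\in P_r$, $\alpha(s_i,H)-\alpha(s_i,H')=\alpha(s_j,H)-\alpha(s_j,H')$. - Relative redistribution: for every history $H$, every round $P_r$ with $|P_r|>1$, every extension $H'$ of $H$ at the $r$-th round, and all $s_i,s_j\in P_r$ with $\alpha(s_i,H)\neq0$ and $\alpha(s_j,H)\ne0$, $\frac{\alpha(s_i,H')}{\alpha(s_i,H)}=\frac{\alpha(s_j,H')}{\alpha(s_j,H)}$. *)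

(* Defs.v *)
From mathcomp Require Import all_boot all_order all_algebra.
From mathcomp Require Import finmap reals.

Set Implicit Arguments.
Unset Strict Implicit.
Unset Printing Implicit Defensive.

Import Order.TTheory GRing.Theory Num.Theory.

Local Open Scope fset_scope.
Local Open Scope ring_scope.

Section Histories.
Variables (R : realType) (Hash : choiceType).

Local Notation share := (Hash * R)%type.

Definition time (s : share) : R := s.2.

Definition earlier (s t : share) : bool := time s < time t.

(* The rounds are given as the sequence P_1, ..., P_l in chronological order:
   they are nonempty, cover S, and every share of an earlier round precedes
   every share of a later one.  Pairwise disjointness, and the fact that each
   round consists of consecutive shares of S, follow; conversely a partition
   of S into nonempty sets of consecutive shares has exactly one such
   listing. *)
Definition is_history (S : {fset share}) (Ps : seq {fset share}) : bool :=
  [&& S != fset0,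
      uniq [seq time s | s <- S],
      fset0 \notin Ps,
      S == \bigcup_(P <- Ps) P
    & pairwise (fun P Q : {fset share} => allrel earlier P Q) Ps].

Record history := History {
  shares : {fset share};
  rounds : seq {fset share};
  historyP : is_history shares rounds
}.

(* Rounds are numbered from 0; the value is the empty set when there is no
   r-th round. *)
Definition round (H : history) (r : nat) : {fset share} :=
  nth fset0 (rounds H) r.

Definition round_of (H : history) (s : share) : {fset share} :=
  nth fset0 (rounds H) (find (fun P : {fset share} => s \in P) (rounds H)).

Definition rank (H : history) (s : share) : nat :=
  #|` [fset t in round_of H s | earlier t s]|.+1.

Lemma round_in (H : history) (r : 'I_(size (rounds H))) :
  round H r \in rounds H.
Proof. exact: mem_nth. Qed.

Lemma restrict_subproof (H : history) (r : 'I_(size (rounds H))) :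
  is_history (round H r) [:: round H r].
Proof.
have /and5P[_ Su Sn0 /eqP SE _] := historyP H.
have rH := round_in r.
have r0 : round H r != fset0 by apply: contraNneq Sn0 => <-.
have rS : {subset round H r <= shares H}.
  by move=> s sr; rewrite SE; apply/bigfcupP; exists (round H r); rewrite ?rH.
apply/and5P; split => //.
- rewrite map_inj_in_uniq ?fset_uniq // => s t /rS sS /rS tS st.
  have /uniqP := Su => /(_ 0) ui.
  have iS : {in shares H, forall x : share,
      (index x (shares H) < size [seq time s | s <- shares H])%N}.
    by move=> x xS; rewrite size_map index_mem.
  have := ui _ _ (iS _ sS) (iS _ tS).
  by rewrite !(nth_map s) ?index_mem // !nth_index // => /(_ st) /index_inj; exact.
- by rewrite inE eq_sym.
- by rewrite big_seq1.
Qed.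

Definition restrict (H : history) (r : 'I_(size (rounds H))) : history :=
  History (restrict_subproof r).

Definition is_extension (H : history) (r : 'I_(size (rounds H)))
    (H' : history) : Prop :=
  exists s' : share,
    [/\ s' \notin shares H,
        {in round H r, forall s, time s < time s'},
        {in round H r.+1, forall s, time s' < time s},
        shares H' = s' |` shares H
      & rounds H' = set_nth fset0 (rounds H) r (s' |` round H r)].

Definition next_share (H : history) (s t : share) : Prop :=
  [/\ s \in shares H, t \in shares H, time s < time t
    & {in shares H, forall u, ~~ (time s < time u < time t)}].

(* The quantifications over neighbours are vacuous when the neighbour does not
   exist. *)
Definition is_time_shift (H : history) (s : share) (H' : history) : Prop :=
  exists (r : 'I_(size (rounds H))) (s' : share),
    [/\ s \in round H r,
        s' \notin shares H,
        (forall t, next_share H t s -> time t < time s') /\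
        (forall t, next_share H s t -> time s' < time t),
        shares H' = s' |` (shares H `\ s)
      & rounds H' = set_nth fset0 (rounds H) r (s' |` (round H r `\ s))].

(* Only the values [award H s] with [s \in shares H] are meaningful; the
   others are unconstrained and never used. *)
Record scheme := Scheme {
  award :> history -> share -> R;
  award_ge0 : forall H s, s \in shares H -> 0 <= award H s
}.

Definition fixed_total_reward (a : scheme) : Prop :=
  forall (H : history) (P Q : {fset share}),
    P \in rounds H -> Q \in rounds H ->
    \sum_(s <- P) a H s = \sum_(s <- Q) a H s.

Definition ordinality (a : scheme) : Prop :=
  forall (H H' : history) (si : share),
    si \in shares H -> is_time_shift H si H' ->
    {in shares H `\ si, forall s, a H s = a H' s}.

Definition budget_limit (B : R) (a : scheme) : Prop :=
  forall (H : history) (P : {fset share}),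
    P \in rounds H -> \sum_(s <- P) a H s <= B.

Definition round_based_rewards (a : scheme) : Prop :=
  forall (H : history) (r : 'I_(size (rounds H))),
    {in round H r, forall s, a H s = a (restrict r) s}.

Definition absolute_redistribution (a : scheme) : Prop :=
  forall (H : history) (r : 'I_(size (rounds H))) (H' : history),
    (1 < #|` round H r|)%N -> is_extension r H' ->
    {in round H r &, forall si sj, a H si - a H' si = a H sj - a H' sj}.

Definition relative_redistribution (a : scheme) : Prop :=
  forall (H : history) (r : 'I_(size (rounds H))) (H' : history),
    (1 < #|` round H r|)%N -> is_extension r H' ->
    {in round H r &, forall si sj, a H si != 0 -> a H sj != 0 ->
      a H' si / a H si = a H' sj / a H sj}.

(* [None] stands for k = oo. *)
Definition pseudo_award (T delta : R) (k : option nat) (n rk : nat) : R :=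
  match k with
  | None => T / n%:R
  | Some k =>
      if (n < k)%N then T / n%:R
      else if (rk < k)%N then (T - delta) / (k.-1)%:R
      else if rk == k then delta
      else 0
  end.

Definition pseudo_proportional (B : R) (k : option nat) (a : scheme) : Prop :=
  exists f delta : R,
    [/\ 0 <= f <= B, 0 <= delta <= B - f
      & forall (H : history) (s : share), s \in shares H ->
          a H s = pseudo_award (B - f) delta k #|` round_of H s| (rank H s)].

End Histories.

(* Main.v *)
Require Import Defs.
From mathcomp Require Import all_boot all_order all_algebra.
From mathcomp Require Import finmap boolp reals.
Import Order.TTheory GRing.Theory Num.Theory.
Local Open Scope ring_scope.

(** By round based rewards only histories with a single round matter.  Since all
rounds of all histories distribute the same total [T], moving one share in time
changes no award, not even that of the moved share, so that awards are
a function [f n i] of the size [n] of the round and the rank [i].  Appending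
a share to a round takes the same amount [d] from each of the [n > 1] old
shares.  If [d > 0], then no award is zero and the relative axiom makes the
[f n i] all equal; if [d = 0], the old awards are unchanged and the new share
gets nothing.  So the awards are [T / n] up to the first size [k] at which they
are not uniform, where [delta] is what the last share gets, and from then on
they are frozen. *)

Set Implicit Arguments.
Unset Strict Implicit.
Unset Printing Implicit Defensive.

(** * Finite sets as duplicate-free lists, up to permutation *)

Section FinSets.
Local Open Scope fset_scope.
Variable K : choiceType.
Implicit Types (A : {fset K}) (u : seq K).

Lemma in_fseq u x : (x \in [fset y in u]) = (x \in u).
Proof. by rewrite !inE. Qed.

Lemma perm_fseq u : uniq u -> perm_eq [fset x in u] u.
Proof. by move=> uu; apply: uniq_perm => // x; rewrite !inE. Qed.

Lemma perm_fsetU1 x A : x \notin A -> perm_eq (x |` A) (x :: A).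
Proof.
by move=> xA; apply: uniq_perm => [||y]; rewrite /= ?xA ?fset_uniq ?inE.
Qed.

Lemma perm_fsetD1 x A : x \in A -> perm_eq A (x :: A `\ x).
Proof.
move=> xA; rewrite -{1}(fsetD1K xA).
by apply: perm_fsetU1; rewrite !inE eqxx.
Qed.

Lemma card_fset_count A (p : pred K) : #|` [fset x in A | p x]| = count p A.
Proof.
rewrite -size_filter; apply: perm_size; apply: uniq_perm => [||x].
- exact: fset_uniq.
- by rewrite filter_uniq ?fset_uniq.
- by rewrite !inE mem_filter andbC.
Qed.

End FinSets.

(** * Rounds and ranks, and their fate under time-shifts and extensions *)

Section Histories.
Local Open Scope fset_scope.
Variables (R : realType) (Hash : choiceType).
Local Notation share := (Hash * R)%type.
Implicit Types (H : history R Hash) (P Q : {fset share}) (s t x y : share).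
Implicit Types (u v w : seq share).

Lemma earlier_trans : transitive (@earlier R Hash).
Proof. by move=> y x z; apply: lt_trans. Qed.

Lemma earlier_irr : irreflexive (@earlier R Hash).
Proof. by move=> x; apply: ltxx. Qed.

Lemma history_ext H H' : shares H = shares H' -> rounds H = rounds H' -> H = H'.
Proof.
case: H H' => [S Ps hP] [S' Ps' hP'] /= eS eP; subst.
by rewrite (bool_irrelevance hP hP').
Qed.

Lemma mem_sharesP H s : reflect (exists i, s \in round H i) (s \in shares H).
Proof.
have /and5P[_ _ _ /eqP-> _] := historyP H.
apply: (iffP (bigfcupP _ _ _ _)) => [[P]|[i si]].
  rewrite andbT => /(nthP fset0)[i _ <-] sP; by exists i.
exists (round H i) => //; rewrite andbT; apply: mem_nth.
by rewrite ltnNge; apply: contraTN si => ?; rewrite /round nth_default.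
Qed.

Lemma round_lt_size H s i : s \in round H i -> (i < size (rounds H))%N.
Proof.
by rewrite ltnNge; apply: contraTN => ?; rewrite /round nth_default.
Qed.

(** A share lying in two different rounds would be strictly earlier than itself. *)
Lemma round_disjoint H s i j : s \in round H i -> s \in round H j -> i = j.
Proof.
have /and5P[_ _ _ _ /(pairwiseP fset0) pw] := historyP H.
move=> si sj; have [iH jH] := (round_lt_size si, round_lt_size sj).
case: (ltngtP i j) => // [ij|ji].
  by have /allrelP/(_ s s si sj) := pw i j iH jH ij; rewrite earlier_irr.
by have /allrelP/(_ s s sj si) := pw j i jH iH ji; rewrite earlier_irr.
Qed.

Lemma round_ofE H s i : s \in round H i -> round_of H s = round H i.
Proof.
move=> si; have iH := round_lt_size si.
have hs : has (fun P : {fset share} => s \in P) (rounds H).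
  by apply/hasP; exists (round H i) => //; apply: mem_nth.
have sf := nth_find fset0 hs; rewrite /round_of.
by rewrite -/(round H _) (round_disjoint sf si).
Qed.

Lemma rankE H s i :
  s \in round H i -> rank H s = (count (@earlier R Hash ^~ s) (round H i)).+1.
Proof. by move=> si; rewrite /rank (round_ofE si) card_fset_count. Qed.

Lemma time_inj H : {in shares H &, injective (@time R Hash)}.
Proof.
have /and5P[_ ut _ _ _] := historyP H.
move=> s t sS tS est; case: (eqVneq s t) => // nst.
have := ut; rewrite (perm_uniq (perm_map _ (perm_fsetD1 sS))) /= est.
by rewrite map_f // !inE eq_sym nst.
Qed.

Lemma mem_shares H s i : s \in round H i -> s \in shares H.
Proof. by move=> si; apply/mem_sharesP; exists i. Qed.

Lemma round_neq0 H i : (i < size (rounds H))%N -> round H i != fset0.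
Proof.
have /and5P[_ _ n0 _ _] := historyP H.
by move=> iH; apply: contraNneq n0 => <-; apply: mem_nth.
Qed.

Lemma mem_roundsP H P :
  P \in rounds H -> exists2 i, (i < size (rounds H))%N & P = round H i.
Proof. by move/(nthP fset0) => [i iH <-]; exists i. Qed.

Lemma count_earlier_index u x : sorted (@earlier R Hash) u -> x \in u ->
  count (@earlier R Hash ^~ x) u = index x u.
Proof.
elim: u => //= y u IH; rewrite (path_sortedE earlier_trans) => /andP[yu su].
rewrite inE; case: (eqVneq x y) => [-> _|nxy /= xu].
  rewrite earlier_irr; apply/eqP; rewrite -leqn0 leqNgt -has_count.
  apply/hasPn => z /(allP yu); rewrite /earlier => yz.
  by rewrite -leNgt ltW.
by rewrite (allP yu _ xu) IH.
Qed.

Lemma sorted_uniq_earlier u : sorted (@earlier R Hash) u -> uniq u.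
Proof. exact: (sorted_uniq earlier_trans earlier_irr). Qed.

Lemma round_sorted H i :
  exists2 u, sorted (@earlier R Hash) u & perm_eq (round H i) u.
Proof.
pose le (s t : share) := time s <= time t.
exists (sort le (round H i)); last by rewrite perm_sym perm_sort.
have -> : @earlier R Hash = relpre (@time R Hash) <%R by [].
rewrite -sorted_map -sort_map sort_lt_sorted map_inj_in_uniq ?fset_uniq //.
by move=> s t /mem_shares sS /mem_shares tS; apply: time_inj sS tS.
Qed.

(** Listed chronologically, the share at position [j] has rank [j.+1], so the sum is reindexed by
    positions. *)
Lemma sum_round H i (F : nat -> R) :
  \sum_(s <- round H i) F (rank H s) = \sum_(j < #|` round H i|) F j.+1.
Proof.
have [u su pu] := round_sorted H i.
rewrite (perm_big _ pu) /= (perm_size pu).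
under eq_big_seq => s sin.
  rewrite (@rankE _ _ i) ?(perm_mem pu) //.
  by rewrite (permP pu) (count_earlier_index su) //; over.
case: u su {pu} => [|x0 u] su; first by rewrite big_nil big_ord0.
rewrite (big_nth x0) big_mkord; apply: eq_bigr => j _.
by rewrite index_uniq // sorted_uniq_earlier.
Qed.

(** A time-shift constrains the moved share only against its immediate neighbours. The neighbour
    [u], the latest share before [t], passes that constraint on to any earlier [s]. *)
Lemma next_share_below H s t :
  s \in shares H -> t \in shares H -> time s < time t ->
  exists2 u, next_share H u t & time s <= time u.
Proof.
move=> sS tS st.
pose below := [pred i : shares H | time (val i) < time t].
have b0 : below [` sS] by [].
case: (@arg_maxP _ _ _ [` sS] below (fun i => time (val i)) b0) => u ut umax.
exists (val u); last exact: (umax _ b0).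
split=> //; first exact: valP.
move=> v vS; apply/negP => /andP[uv vt].
by have : time v <= time (val u) := umax [` vS] vt; rewrite leNgt uv.
Qed.

Lemma next_share_above H s t :
  s \in shares H -> t \in shares H -> time s < time t ->
  exists2 u, next_share H s u & time u <= time t.
Proof.
move=> sS tS st.
pose above := [pred i : shares H | time s < time (val i)].
have b0 : above [` tS] by [].
case: (@arg_minP _ _ _ [` tS] above (fun i => time (val i)) b0) => u su umin.
exists (val u); last exact: (umin _ b0).
split=> //; first exact: valP.
move=> v vS; apply/negP => /andP[sv vu].
by have : time (val u) <= time v := umin [` vS] sv; rewrite leNgt vu.
Qed.

(** Staying between its neighbours, the moved share stays on the same side of every other share. *)
Lemma time_shift_round_rank H H' s s' :
  is_time_shift H s H' -> s' \in shares H `\ s ->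
  #|` round_of H' s'| = #|` round_of H s'| /\ rank H' s' = rank H s'.
Proof.
case=> r [y [sr yS [lo hi] _ eR]]; rewrite 2!inE => /andP[ns s'S].
have [i s'i] := mem_sharesP _ _ s'S.
have nR j : round H' j = if j == r then y |` (round H r `\ s) else round H j.
  by rewrite /round eR nth_set_nth.
have [ir|nir] := eqVneq i r; last first.
  have s'i' : s' \in round H' i by rewrite nR (negPf nir).
  rewrite (rankE s'i) (rankE s'i') (round_ofE s'i) (round_ofE s'i') nR.
  by rewrite (negPf nir).
subst i.
have s'i' : s' \in round H' r by rewrite nR eqxx !inE ns s'i orbT.
rewrite (rankE s'i) (rankE s'i') (round_ofE s'i) (round_ofE s'i') nR eqxx.
have yr : y \notin round H r `\ s.
  by apply: contra yS; rewrite 2!inE => /andP[_ /mem_shares].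
have p1 := perm_fsetD1 sr; have p2 := perm_fsetU1 yr.
split; first by rewrite (perm_size p1) (perm_size p2).
(* Both rounds consist of one distinguished share, [s] or its replacement [y], and the same rest.
   Only the order of that share relative to [s'] is left to compare. *)
rewrite (permP p1) (permP p2) /=; congr ((nat_of_bool _ + _)%N.+1).
have sS := mem_shares sr.
rewrite /earlier; case: (ltgtP (time s) (time s')) => [lt|gt|eq].
- have [u /hi yu us] := next_share_above sS s'S lt.
  exact: lt_le_trans yu us.
- have [u /lo uy su] := next_share_below s'S sS gt.
  by apply/negbTE; rewrite -leNgt ltW // (le_lt_trans su).
- by rewrite (time_inj sS s'S eq) eqxx in ns.
Qed.

(** The added share comes last in its round, so it precedes none of the old ones. *)
Lemma extension_round_rank H (r : 'I_(size (rounds H))) H' s :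
  is_extension r H' -> s \in round H r ->
  #|` round_of H' s| = #|` round_of H s|.+1 /\ rank H' s = rank H s.
Proof.
case=> y [yS lo hi _ eR] sr.
have yr : y \notin round H r by apply: contra yS => /mem_shares.
have eq' : round H' r = y |` round H r by rewrite /round eR nth_set_nth /= eqxx.
have sr' : s \in round H' r by rewrite eq' !inE sr orbT.
have p := perm_fsetU1 yr.
rewrite (rankE sr) (rankE sr') (round_ofE sr) (round_ofE sr') eq' (perm_size p).
split=> //; rewrite (permP p) /=.
by rewrite /earlier ltNge ltW // lo.
Qed.

Lemma rank_le H s : s \in shares H -> (rank H s <= #|` round_of H s|)%N.
Proof.
move=> /mem_sharesP[i si]; rewrite (rankE si) (round_ofE si).
rewrite -(count_predC (@earlier R Hash ^~ s)) -addn1 leq_add2l -has_count.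
by apply/hasP; exists s; rewrite //= earlier_irr.
Qed.

End Histories.

Arguments earlier_trans {R Hash}.

(** * The pseudo-proportional award formula *)

Section PseudoAward.
Variables (R : realType) (T delta : R) (k : option nat).
Hypothesis k_ge2 : forall m, k = Some m -> (1 < m)%N.

Lemma sum_pseudo_award n : (0 < n)%N ->
  \sum_(j < n) pseudo_award T delta k n j.+1 = T.
Proof.
move=> n0.
have sT : \sum_(j < n) (T / n%:R) = T.
  by rewrite sumr_const card_ord -[LHS]mulr_natr divfK // pnatr_eq0 -lt0n.
case: k k_ge2 => [m|] //= /(_ m erefl); case: m => [|[|m]] // _.
rewrite /pseudo_award; case: ltnP => // mn.
rewrite -(big_mkord xpredT (fun j =>
  if (j.+1 < m.+2)%N then (T - delta) / m.+1%:R
  else if j.+1 == m.+2 then delta else 0)) /=.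
(* Here [k = m.+2] and positions count from 0: the first [m.+1] split [T - delta], position [m.+1]
   has rank [k] and gets [delta], and the later ones get 0. *)
rewrite (@big_cat_nat _ _ _ m.+1) //=; last exact: ltnW.
rewrite (@eq_big_nat _ _ _ 0 m.+1 _ (fun=> (T - delta) / m.+1%:R)); last first.
  by move=> j /andP[_ jm]; rewrite ltnS jm.
rewrite sumr_const_nat subn0 -[X in X + _]mulr_natr divfK ?pnatr_eq0 //.
rewrite big_ltn // ltnn eqxx.
rewrite (@eq_big_nat _ _ _ m.+2 n _ (fun=> 0)); last first.
  by move=> j /andP[mj _]; rewrite ltnS ltnNge ltnW //= gtn_eqF.
by rewrite sumr_const_nat mul0rn addr0 subrK.
Qed.

(** The alternative behind both redistribution axioms: equal awards change equally, and frozen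
    awards do not change. *)
Lemma pseudo_awardS n i j : (i <= n)%N -> (j <= n)%N ->
  let A := pseudo_award T delta k in
  A n i = A n j /\ A n.+1 i = A n.+1 j \/ A n.+1 i = A n i /\ A n.+1 j = A n j.
Proof.
move=> iN jN A; rewrite /A /pseudo_award.
case: k => [m|]; last by left.
have [nm|mn] := ltnP n m; last by right; rewrite ltnNge leqW.
by left; rewrite (leq_ltn_trans iN nm) (leq_ltn_trans jN nm).
Qed.

End PseudoAward.

(** * Pseudo-proportional schemes satisfy the axioms *)

Section Converse.
Variables (R : realType) (Hash : choiceType) (a : scheme R Hash).
Variables (T delta : R) (k : option nat).
Hypothesis k_ge2 : forall m, k = Some m -> (1 < m)%N.
Hypothesis award_pseudo : forall (H : history R Hash) s, s \in shares H ->
  a H s = pseudo_award T delta k #|` round_of H s| (rank H s).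

Lemma pseudo_award_total H P : P \in rounds H -> \sum_(s <- P) a H s = T.
Proof.
case/mem_roundsP => i iH ->.
under eq_big_seq => s si.
  by rewrite (award_pseudo (mem_shares si)) (round_ofE si); over.
rewrite (@sum_round _ _ _ _ (pseudo_award T delta k #|` round H i|)).
by rewrite sum_pseudo_award // cardfs_gt0 round_neq0.
Qed.

Lemma pseudo_award_ordinality : ordinality a.
Proof.
move=> H H' s sS sh s' s'S.
have [ec er] := time_shift_round_rank sh s'S.
have s'S' : s' \in shares H'.
  by case: sh => r [y [_ _ _ -> _]]; rewrite inE s'S orbT.
rewrite award_pseudo ?award_pseudo ?ec ?er //.
by move: s'S; rewrite 2!inE => /andP[].
Qed.

Lemma pseudo_award_round_based : round_based_rewards a.
Proof.
move=> H r s sr.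
have sr' : s \in round (restrict r) 0 by [].
rewrite !award_pseudo ?(mem_shares sr) //.
by rewrite (round_ofE sr) (round_ofE sr') (rankE sr) (rankE sr').
Qed.

Lemma pseudo_award_extension H (r : 'I_(size (rounds H))) H' si sj :
  is_extension r H' -> si \in round H r -> sj \in round H r ->
  a H si = a H sj /\ a H' si = a H' sj \/ a H' si = a H si /\ a H' sj = a H sj.
Proof.
move=> ex ir jr.
have [ci ri] := extension_round_rank ex ir.
have [cj rj] := extension_round_rank ex jr.
have sub : {subset shares H <= shares H'}.
  by case: ex => y [_ _ _ -> _] s sH; rewrite inE sH orbT.
have [iS jS] := (mem_shares ir, mem_shares jr).
have [li lj] := (rank_le iS, rank_le jS).
rewrite !award_pseudo ?sub // ci ri cj rj.
move: li lj; rewrite (round_ofE ir) (round_ofE jr) => li lj.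
exact: pseudo_awardS.
Qed.

Lemma pseudo_award_absolute : absolute_redistribution a.
Proof.
move=> H r H' _ ex si sj ir jr.
by have [[-> ->]|[-> ->]] := pseudo_award_extension ex ir jr; rewrite ?subrr.
Qed.

Lemma pseudo_award_relative : relative_redistribution a.
Proof.
move=> H r H' _ ex si sj ir jr i0 j0.
by have [[-> ->]|[-> ->]] := pseudo_award_extension ex ir jr; rewrite ?divff.
Qed.

End Converse.

(** * Arithmetic of awards indexed by round size and position *)

Section RedistributionArithmetic.
Variables (R : realType) (T : R) (f : nat -> nat -> R).
Hypothesis f_ge0 : forall n i, (i < n)%N -> 0 <= f n i.
Hypothesis f_sum : forall n, (0 < n)%N -> \sum_(i < n) f n i = T.
Hypothesis f_abs : forall n i j, (1 < n)%N -> (i < n)%N -> (j < n)%N ->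
  f n i - f n.+1 i = f n j - f n.+1 j.
Hypothesis f_rel : forall n i j, (1 < n)%N -> (i < n)%N -> (j < n)%N ->
  f n i != 0 -> f n j != 0 -> f n.+1 i / f n i = f n.+1 j / f n j.

(* A positive common loss [d] makes all awards nonzero, and then the common
   ratio [1 - d / f n i] makes them equal. *)
Lemma unequal_awards_freeze n i j : (1 < n)%N -> (i < n)%N -> (j < n)%N ->
  f n i != f n j ->
  (forall l, (l < n)%N -> f n.+1 l = f n l) /\ f n.+1 n = 0.
Proof.
move=> n1 iN jN fij; have n0 : (0 < n)%N by apply: ltnW.
have [d fd] : exists d, forall l, (l < n)%N -> f n.+1 l = f n l - d.
  by exists (f n 0 - f n.+1 0) => l lN; rewrite (f_abs n1 n0 lN) subKr.
(* The totals at sizes [n] and [n.+1] are both [T], so the new share collects what the [n] old ones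
   lose. *)
have last_nd : f n.+1 n = d *+ n.
  have := f_sum (ltn0Sn n); rewrite big_ord_recr /=.
  under eq_bigr => l _ do rewrite fd //.
  rewrite big_split /= f_sum // sumr_const card_ord mulNrn -addrA.
  by rewrite -[RHS]addr0 => /addrI/eqP; rewrite addrC subr_eq0 => /eqP.
have d_ge0 : 0 <= d.
  by have := f_ge0 (ltnSn n); rewrite last_nd pmulrn_lge0.
have [d0|dn0] := eqVneq d 0.
  by split=> [l lN|]; [rewrite fd // d0 subr0 | rewrite last_nd d0 mul0rn].
have d_gt0 : 0 < d by rewrite lt_def dn0.
(* Awards at size [n.+1] are nonnegative, so each old award was at least [d]. *)
have f_gt0 l : (l < n)%N -> 0 < f n l.
  move=> lN; rewrite (lt_le_trans d_gt0) // -subr_ge0 -fd //.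
  by apply: f_ge0; apply: leqW.
have [fi fj] := (lt0r_neq0 (f_gt0 _ iN), lt0r_neq0 (f_gt0 _ jN)).
have := f_rel n1 iN jN fi fj; rewrite (fd i) // (fd j) // !mulrBl !divff //.
move=> /addrI/oppr_inj e; case/eqP: fij.
by apply: invr_inj; apply: (mulfI dn0).
Qed.

Lemma pseudo_award_of_redistribution :
  exists (k : option nat) (delta : R),
    [/\ forall m, k = Some m -> (1 < m)%N, 0 <= delta <= T
      & forall n i, (i < n)%N -> f n i = pseudo_award T delta k n i.+1].
Proof.
have T0 : 0 <= T by rewrite -(@f_sum 1) // big_ord1 f_ge0.
pose uniform n := [forall i : 'I_n, f n i == T / n%:R].
have uniformE n i : uniform n -> (i < n)%N -> f n i = T / n%:R.
  by move=> /forallP un iN; have /eqP := un (Ordinal iN).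
case: (EM (exists n, ~~ uniform n)) => [nun|un]; last first.
  exists None, 0; split=> // [|n i iN]; first by rewrite lexx.
  by rewrite /= uniformE //; apply/negPn/negP => nu; apply: un; exists n.
case: (ex_minnP nun) => k nuk kmin.
have {kmin} un n : (n < k)%N -> uniform n.
  by rewrite ltnNge; apply: contraNT => /kmin.
(* Size 0 is vacuously uniform and size 1 is uniform by [f_sum], so the least non-uniform size is at
   least 2. *)
case: k nuk un => [|[|m]] nuk un.
- by case/negP: nuk; apply/forallP => -[].
- case/negP: nuk; apply/forallP => i; rewrite ord1 divr1.
  by have := @f_sum 1 isT; rewrite big_ord1 => ->.
set delta := f m.+2 m.+1; set c := f m.+2 0.
(* For [m > 0] the awards at size [m.+1] are uniform, and absolute redistribution keeps them equal
   one size later. For [m = 0] only position 0 is concerned. *)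
have cE i : (i < m.+1)%N -> f m.+2 i = c.
  case: m un @c {delta nuk} => [|m] un c; first by case: i.
  move=> im; have um := un m.+2 (ltnSn _).
  have := f_abs (isT : (1 < m.+2)%N) im (ltn0Sn _).
  by rewrite !(uniformE _ _ um) // => /addrI/oppr_inj.
have sumE : c *+ m.+1 + delta = T.
  rewrite -(@f_sum m.+2) // big_ord_recr /=; congr (_ + _).
  by rewrite (eq_bigr (fun=> c)) ?sumr_const ?card_ord // => i _; apply: cE.
have cdelta : c != delta.
  apply: contraNneq nuk => ecd; apply/forallP => i.
  have -> : f m.+2 i = c.
    case: (ltngtP i m.+1) (ltn_ord i) => [im _|im|-> _] //; first exact: cE.
    by rewrite ltnS leqNgt im.
  apply/eqP; rewrite -sumE -ecd addrC -mulrS -[c *+ _]mulr_natr mulfK //.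
  by rewrite pnatr_eq0.
have c_ge0 : 0 <= c by apply: f_ge0.
exists (Some m.+2), delta; split=> [_ [<-] //||n i iN].
  by rewrite f_ge0 // -sumE lerDr mulrn_wge0.
rewrite /pseudo_award; case: ltnP => [nm|mn].
  exact: uniformE (un _ nm) iN.
(* The unequal awards [c] and [delta] at positions 0 and [m.+1] persist, so [unequal_awards_freeze]
   applies again at each larger size. *)
have stable p : (forall l, (l < m.+2)%N -> f (m.+2 + p)%N l = f m.+2 l) /\
    (forall l, (m.+2 <= l < m.+2 + p)%N -> f (m.+2 + p)%N l = 0).
  elim: p => [|p [IH1 IH2]].
    by rewrite addn0; split=> // l; rewrite leqNgt andNb.
  have n1 : (1 < m.+2 + p)%N by [].
  have mN : (m.+1 < m.+2 + p)%N by rewrite leq_addr.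
  have [st z] := @unequal_awards_freeze (m.+2 + p)%N 0%N m.+1 n1 isT mN
                   ltac:(by rewrite !IH1).
  rewrite addnS; split=> l.
    by move=> lm; rewrite st ?IH1 // (leq_trans lm) ?leq_addr.
  case/andP=> ml; rewrite ltnS leq_eqVlt => /orP[/eqP->//|lN].
  by rewrite st // IH2 // ml.
have [st z] := stable (n - m.+2)%N; rewrite subnKC // in st z.
rewrite ltnS; case: (ltngtP i m.+1) => [im|im|->]; last by rewrite st ?eqxx.
  rewrite st ?cE //; last exact: ltnW.
  by rewrite -sumE addrK -[c *+ _]mulr_natr mulfK // pnatr_eq0.
by rewrite z ?im // eqSS gtn_eqF.
Qed.

End RedistributionArithmetic.

(** * Reducing awards to a function of round size and rank *)

Section OneRound.
Local Open Scope fset_scope.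
Local Open Scope ring_scope.
Variables (R : realType) (Hash : choiceType).
Local Notation share := (Hash * R)%type.
Local Notation sorted := (sorted (@earlier R Hash)).
Implicit Types (H : history R Hash) (x y z : share) (u v : seq share).

Lemma uniq_time_fseq u : sorted u -> uniq [seq time s | s <- [fset x in u]].
Proof.
move=> su; have uu := sorted_uniq_earlier su.
rewrite (perm_uniq (perm_map _ (perm_fseq uu))).
apply: (sorted_uniq lt_trans ltxx); by rewrite sorted_map.
Qed.

Lemma fseq_neq0 u : u != [::] -> [fset x in u] != fset0.
Proof.
case: u => // x u _; apply/eqP => /fsetP/(_ x).
by rewrite !inE eqxx.
Qed.

Lemma one_round_history u : u != [::] -> sorted u ->
  is_history [fset x in u] [:: [fset x in u]].
Proof.
move=> u0 su; apply/and5P; split=> //=; rewrite ?fseq_neq0 ?uniq_time_fseq //.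
- by rewrite inE eq_sym fseq_neq0.
- by rewrite big_seq1.
Qed.

Lemma two_round_history u v : u != [::] -> v != [::] -> sorted (u ++ v) ->
  is_history [fset x in u ++ v] [:: [fset x in u]; [fset x in v]].
Proof.
move=> u0 v0 suv; apply/and5P; split=> /=; rewrite ?uniq_time_fseq //.
- by apply: fseq_neq0; case: u u0 {suv}.
- by rewrite !inE negb_or ![fset0 == _]eq_sym !fseq_neq0.
- rewrite !big_cons big_nil fsetU0; apply/eqP/fsetP => x.
  by rewrite !inE.
- rewrite !andbT; apply/allrelP => x y; rewrite !in_fseq => xu yv.
  move: suv; rewrite (sorted_pairwise earlier_trans) pairwise_cat.
  by case/andP => /allrelP/(_ x y xu yv).
Qed.

(** A standard round of any size, which a large [M] puts after any given shares. *)
Definition time_run (h : Hash) (M : R) (n : nat) : seq share :=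
  mkseq (fun i => (h, M + i%:R)) n.

Lemma time_run_sorted h M n : sorted (time_run h M n).
Proof.
rewrite /time_run /mkseq sorted_map.
apply: sub_sorted (iota_ltn_sorted 0 n) => i j ij.
by rewrite /= /earlier /time /= ltrD2l ltr_nat.
Qed.

Lemma cat_time_run_sorted h M n u : sorted u ->
  {in u, forall x, time x < M} -> sorted (u ++ time_run h M n).
Proof.
move=> su uM; rewrite (sorted_pairwise earlier_trans) pairwise_cat.
rewrite -!(sorted_pairwise earlier_trans) su time_run_sorted !andbT.
apply/allrelP => x y xu /mapP[i _ ->]; rewrite /earlier {2}/time /=.
by rewrite (lt_le_trans (uM x xu)) // lerDl.
Qed.

Lemma time_bound u : exists M, {in u, forall x, time x < M}.
Proof.
elim: u => [|y u [M uM]]; first by exists 0.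
exists (Num.max M (time y + 1)) => x; rewrite inE lt_max.
by case/orP => [/eqP->|/uM->//]; rewrite ltrDl ltr01 orbT.
Qed.

Variable a : scheme R Hash.

(* [0] when [u] is empty or has two shares with the same time. *)
Definition seq_award u x : R :=
  if pselect (is_history [fset x in u] [:: [fset x in u]]) is left uP
  then a (History uP) x else 0.

Definition seq_awards u : seq R := [seq seq_award u x | x <- u].

Lemma seq_awardE u x (uP : is_history [fset x in u] [:: [fset x in u]]) :
  seq_award u x = a (History uP) x.
Proof.
rewrite /seq_award; case: pselect => // uP'.
by rewrite (bool_irrelevance uP uP').
Qed.

Lemma seq_award_ge0 u x : x \in u -> 0 <= seq_award u x.
Proof.
rewrite /seq_award; case: pselect => // uP xu.
by apply: award_ge0; rewrite in_fseq.
Qed.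

Hypothesis rb : round_based_rewards a.
Hypothesis ftr : fixed_total_reward a.
Hypothesis ord : ordinality a.

(** Round based rewards replace [H] by its restriction, which is the one-round history on the shares
    of [u]. *)
Lemma award_seq_award H i u x : perm_eq (round H i) u -> x \in round H i ->
  a H x = seq_award u x.
Proof.
move=> pu xi; have eu : round H i = [fset x in u].
  by apply/fsetP => y; rewrite (perm_mem pu) !inE.
pose r := Ordinal (round_lt_size xi).
rewrite (@rb H r) //.
have uP : is_history [fset x in u] [:: [fset x in u]].
  by rewrite -eu; apply: (restrict_subproof r).
rewrite (seq_awardE _ uP); congr (a _ _).
by apply: history_ext; rewrite /= ?eu //; congr [:: _].
Qed.

(** Here [u] and [v] form the two rounds of one history, to which fixed total reward applies. *)
Lemma sum_seq_award_cat u v : u != [::] -> v != [::] -> sorted (u ++ v) ->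
  \sum_(x <- u) seq_award u x = \sum_(x <- v) seq_award v x.
Proof.
move=> u0 v0 suv; have [su sv] := cat_sorted2 suv.
pose H := History (two_round_history u0 v0 suv).
have pu := perm_fseq (sorted_uniq_earlier su).
have pv := perm_fseq (sorted_uniq_earlier sv).
have eu : \sum_(x <- u) a H x = \sum_(x <- u) seq_award u x.
  apply: eq_big_seq => x xu.
  by apply: (@award_seq_award H 0%N); rewrite ?(perm_mem pu).
have ev : \sum_(x <- v) a H x = \sum_(x <- v) seq_award v x.
  apply: eq_big_seq => x xv.
  by apply: (@award_seq_award H 1%N); rewrite ?(perm_mem pv).
rewrite -eu -ev -(perm_big _ pu) -(perm_big _ pv) /=.
by apply: ftr; rewrite !inE eqxx ?orbT.
Qed.

Variable h : Hash.

(** The times of [u] and [v] may interleave, so each is compared with a one-share round later than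
    both. *)
Lemma sum_seq_award u v : u != [::] -> v != [::] -> sorted u -> sorted v ->
  \sum_(x <- u) seq_award u x = \sum_(x <- v) seq_award v x.
Proof.
move=> u0 v0 su sv; have [M uvM] := time_bound (u ++ v).
have far w : w != [::] -> sorted w -> {subset w <= u ++ v} ->
    \sum_(x <- w) seq_award w x =
    \sum_(x <- time_run h M 1) seq_award (time_run h M 1) x.
  move=> w0 sw wuv; apply: sum_seq_award_cat => //.
  by apply: cat_time_run_sorted => // x /wuv /uvM.
by rewrite !far // => x xw; rewrite mem_cat xw ?orbT.
Qed.

(** Ordinality settles every share but the moved one, whose award is then the common total minus the
    others. *)
Lemma seq_awards_shift u v x y : sorted (u ++ x :: v) -> sorted (u ++ y :: v) ->
  seq_awards (u ++ x :: v) = seq_awards (u ++ y :: v).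
Proof.
(* The replacement in a time-shift must lie outside the history, hence the separate case [x = y]. *)
move=> sx sy; have [->//|nxy] := eqVneq x y.
have x0 : u ++ x :: v != [::] by case: (u).
have y0 : u ++ y :: v != [::] by case: (u).
have xP := one_round_history x0 sx; have yP := one_round_history y0 sy.
have ux := sorted_uniq_earlier sx; have uy := sorted_uniq_earlier sy.
have memx z : (z \in u ++ x :: v) = (z == x) || (z \in u ++ v).
  by rewrite !mem_cat inE orbCA.
have memy z : (z \in u ++ y :: v) = (z == y) || (z \in u ++ v).
  by rewrite !mem_cat inE orbCA.
have xuv : x \notin u ++ v.
  by move: ux; rewrite -cat1s uniq_catCA /= => /andP[].
have yuv : y \notin u ++ v.
  by move: uy; rewrite -cat1s uniq_catCA /= => /andP[].
have pairs z : sorted (u ++ z :: v) ->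
    {in u, forall t, earlier t z} /\ {in v, forall t, earlier z t}.
  rewrite (sorted_pairwise earlier_trans) pairwise_cat /=.
  case/and4P=> /allrelP uz _ zv _; split=> t tu.
    by apply: uz => //; rewrite inE eqxx.
  exact: (allP zv).
have [[ux' xv'] [uy' yv']] := (pairs _ sx, pairs _ sy).
have sh : is_time_shift (History xP) x (History yP).
  exists (ord0 : 'I_1), y; split.
  - by rewrite /round /= in_fseq memx eqxx.
  - by rewrite /= in_fseq memx negb_or eq_sym nxy.
  (* A share before [x] lies in [u] and so precedes [y]; one after [x] lies in [v] and so follows
     [y]. *)
  - split=> t; rewrite /next_share /= !in_fseq !memx !mem_cat.
      case=> /or3P + _ tx _; case=> [/eqP e|/uy'//|/xv' xt].
        by rewrite e ltxx in tx.
      by have := lt_trans tx xt; rewrite ltxx.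
    case=> _ /or3P + xt _; case=> [/eqP e|/ux' tx|/yv'//].
      by rewrite e ltxx in xt.
    by have := lt_trans tx xt; rewrite ltxx.
  - apply/fsetP => z; rewrite /= in_fset1U in_fsetD1 !in_fseq memx memy.
    by case: eqVneq => //= _; case: eqVneq => [->|] //=; rewrite (negPf xuv).
  - congr [:: _]; apply/fsetP => z.
    rewrite /round /= in_fset1U in_fsetD1 !in_fseq memx memy.
    by case: eqVneq => //= _; case: eqVneq => [->|] //=; rewrite (negPf xuv).
have same z : z \in u ++ v ->
    seq_award (u ++ x :: v) z = seq_award (u ++ y :: v) z.
  move=> zuv; rewrite (seq_awardE _ xP) (seq_awardE _ yP).
  apply: (ord _ sh); rewrite /= ?in_fsetD1 in_fseq memx ?eqxx // zuv orbT andbT.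
  by apply: contraNneq xuv => <-.
have := sum_seq_award x0 y0 sx sy.
rewrite !big_cat !big_cons /= !(addrCA (\sum_(i <- u) _)) -!big_cat /=.
rewrite (eq_big_seq _ same) => /addIr exy.
rewrite /seq_awards !map_cat /= exy; congr (_ ++ _ :: _).
  by apply/eq_in_map => z zu; apply: same; rewrite mem_cat zu.
by apply/eq_in_map => z zv; apply: same; rewrite mem_cat zv orbT.
Qed.

(** Trading the last share of [u] for the last of [v] keeps the list sorted; the new share then
    joins the tail [w], and induction moves the rest. *)
Lemma seq_awards_cat u v w : size u = size v -> sorted (u ++ v ++ w) ->
  seq_awards (u ++ w) = seq_awards (v ++ w).
Proof.
elim/last_ind: u v w => [|u x IH] v w.
  by move/esym/size0nil => ->.
case/lastP: v => [|v y]; first by rewrite size_rcons.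
rewrite !size_rcons => -[suv]; rewrite !cat_rcons => s.
have sub t : subseq t (u ++ x :: v ++ y :: w) -> sorted t.
  by move/(subseq_sorted earlier_trans); apply.
rewrite (@seq_awards_shift u w x y); first apply: IH => //.
- by apply: sub; rewrite subseq_cat2l subseq_cons.
- apply: sub; rewrite subseq_cat2l -cat1s -[x :: v ++ _]cat1s cat_subseq //.
  by rewrite -[w in subseq w _]cat0s cat_subseq ?sub0seq // subseq_cons.
- apply: sub; rewrite subseq_cat2l -[y :: w]cat0s -[x :: _]cat1s.
  by rewrite -cat1s (@cat_subseq _ [::] _ [:: x]) // suffix_subseq.
Qed.

(* Both rounds are moved, last share first, onto a third one that lies after
   them. *)
Lemma seq_awards_eq_size u v : size u = size v -> sorted u -> sorted v ->
  seq_awards u = seq_awards v.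
Proof.
move=> suv su sv; have [M uvM] := time_bound (u ++ v).
have far w : size w = size u -> sorted w -> {subset w <= u ++ v} ->
    seq_awards w = seq_awards (time_run h M (size u)).
  move=> sz sw wuv; rewrite -[w in LHS]cats0 -[time_run _ _ _ in RHS]cats0.
  apply: seq_awards_cat; first by rewrite size_mkseq.
  by rewrite cats0; apply: cat_time_run_sorted => // x /wuv /uvM.
by rewrite !far // => x xw; rewrite mem_cat xw ?orbT.
Qed.

(** This is the [f] fed to the arithmetic above. Positions [i] count from 0, and [0 + i%:R] matches
    the entries of [time_run] with [M = 0]. *)
Definition rank_award (n i : nat) : R :=
  seq_award (time_run h 0 n) (h, 0 + i%:R).

Lemma mem_time_run M n i : (i < n)%N -> (h, M + i%:R) \in time_run h M n.
Proof. by move=> iN; apply: map_f; rewrite mem_iota. Qed.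

Lemma time_run_neq0 M n : (0 < n)%N -> time_run h M n != [::].
Proof. by case: n. Qed.

(** The sorted round and the standard round of its size have the same award list, which is read at
    the position of [x], its rank minus one. *)
Lemma award_rank H x : x \in shares H ->
  a H x = rank_award #|` round_of H x| (rank H x).-1.
Proof.
case/mem_sharesP=> i xi; have [u su pu] := round_sorted H i.
rewrite (award_seq_award pu xi) (round_ofE xi) (rankE xi) (perm_size pu) /=.
have xu : x \in u by rewrite -(perm_mem pu).
rewrite (permP pu) (count_earlier_index su xu).
have := @seq_awards_eq_size u (time_run h 0 (size u)).
rewrite size_mkseq time_run_sorted => /(_ erefl su isT).
move/(congr1 (fun s => nth 0 s (index x u))).
rewrite (nth_map x) ?index_mem // nth_index // => ->.
rewrite (nth_map x) ?size_mkseq ?index_mem //.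
by rewrite nth_mkseq ?index_mem.
Qed.

Lemma sum_rank_award n : (0 < n)%N ->
  \sum_(i < n) rank_award n i = rank_award 1 0.
Proof.
move=> n0.
have -> : rank_award 1 0 =
    \sum_(x <- time_run h 0 1) seq_award (time_run h 0 1) x.
  by rewrite big_seq1.
rewrite (@sum_seq_award _ (time_run h 0 n)) ?time_run_neq0 ?time_run_sorted //.
by rewrite [RHS]big_map -[n in iota _ n]subn0 big_mkord.
Qed.

Lemma rank_award_ge0 n i : (i < n)%N -> 0 <= rank_award n i.
Proof. by move=> iN; apply/seq_award_ge0/mem_time_run. Qed.

Definition run_history n (n0 : (0 < n)%N) : history R Hash :=
  History (one_round_history (time_run_neq0 0 n0) (time_run_sorted h 0 n)).

Lemma rank_awardE n (n0 : (0 < n)%N) i :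
  rank_award n i = a (run_history n0) (h, 0 + i%:R).
Proof. exact: seq_awardE. Qed.

(** Through this extension the redistribution axioms pass to [rank_award]; the added share has time
    [n]. *)
Lemma run_history_extension n (n0 : (0 < n)%N) :
  @is_extension _ _ (run_history n0) ord0 (run_history (ltn0Sn n)).
Proof.
have E : [fset x in time_run h 0 n.+1]
    = (h, 0 + n%:R) |` [fset x in time_run h 0 n].
  apply/fsetP => x; rewrite /time_run mkseqS !inE mem_rcons inE.
  by congr (_ || _); rewrite !inE.
have lt_n x : x \in time_run h 0 n -> time x < 0 + n%:R.
  case/mapP=> i; rewrite mem_iota /= add0n => iN ->.
  by rewrite /time /= ltrD2l ltr_nat.
exists (h, 0 + n%:R); split=> //=.
- by rewrite inE; apply/negP => /lt_n; rewrite ltxx.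
- by move=> x; rewrite inE => /lt_n.
- by rewrite E.
Qed.

Hypothesis ar : absolute_redistribution a.
Hypothesis rr : relative_redistribution a.

Lemma rank_award_absolute n i j : (1 < n)%N -> (i < n)%N -> (j < n)%N ->
  rank_award n i - rank_award n.+1 i = rank_award n j - rank_award n.+1 j.
Proof.
move=> n1 iN jN; have n0 := ltnW n1.
rewrite !(rank_awardE n0) !(rank_awardE (ltn0Sn n)).
apply: (ar _ (run_history_extension n0)); rewrite ?inE ?mem_time_run //.
rewrite (perm_size (perm_fseq (sorted_uniq_earlier (time_run_sorted _ _ _)))).
by rewrite size_mkseq.
Qed.

Lemma rank_award_relative n i j : (1 < n)%N -> (i < n)%N -> (j < n)%N ->
  rank_award n i != 0 -> rank_award n j != 0 ->
  rank_award n.+1 i / rank_award n i = rank_award n.+1 j / rank_award n j.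
Proof.
move=> n1 iN jN; have n0 := ltnW n1.
rewrite !(rank_awardE n0) !(rank_awardE (ltn0Sn n)).
apply: (rr _ (run_history_extension n0)); rewrite ?inE ?mem_time_run //.
rewrite (perm_size (perm_fseq (sorted_uniq_earlier (time_run_sorted _ _ _)))).
by rewrite size_mkseq.
Qed.

End OneRound.

Theorem theorem3 (R : realType) (Hash : choiceType) (hHash : inhabited Hash)
    (B : R) (hB : 0 < B) (a : scheme R Hash) :
  (round_based_rewards a /\ budget_limit B a /\ fixed_total_reward a /\
   ordinality a /\ absolute_redistribution a /\ relative_redistribution a) <->
  exists k : option nat,
    (if k is Some m then (2 <= m)%N else True) /\ pseudo_proportional B k a.
Proof.
split=> [[rb [bl [ftr [ord [ar rr]]]]]|]; last first.
  case=> k [k2 [f [delta [/andP[f0 _] _ aE]]]].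
  have {}k2 m : k = Some m -> (1 < m)%N by move=> km; rewrite km in k2.
  have tot := pseudo_award_total k2 aE.
  split; first exact: pseudo_award_round_based aE.
  split; first by move=> H P PH; rewrite (tot H P PH) gerBl.
  split; first by move=> H P Q PH QH; rewrite (tot H P PH) (tot H Q QH).
  split; first exact: pseudo_award_ordinality aE.
  split; first exact: pseudo_award_absolute aE.
  exact: pseudo_award_relative aE.
(* The award of a lone share is the total of every standard round, by [sum_rank_award]; the budget
   limit on the one-share history bounds it by [B]. *)
case: hHash => h; pose T := rank_award a h 1 0.
have T0 : 0 <= T by apply: rank_award_ge0.
have TB : T <= B.
  have /= := bl (run_history R h (ltn0Sn 0)) _ (mem_head _ _).
  have su : uniq (time_run h (0 : R) 1) by [].
  by rewrite (perm_big _ (perm_fseq su)) big_seq1 -rank_awardE.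
have [k [delta [k2 dT fE]]] := pseudo_award_of_redistribution
  (rank_award_ge0 a h) (sum_rank_award rb ftr h)
  (rank_award_absolute h ar) (rank_award_relative rr).
exists k; split; first by case: k k2 {fE} => // m; apply.
(* The fee [B - T] is chosen so that the distributed reward is [T]. *)
exists (B - T), delta; rewrite subKr; split=> //.
  by rewrite subr_ge0 TB gerBl.
(* Ranks start at 1 and positions at 0, so the bound required of [(rank H s).-1] is exactly
   [rank_le]. *)
move=> H s sH; rewrite (award_rank rb ftr ord h sH) fE //.
exact: rank_le.
Qed.
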